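(* Let $n\ge 1$ and let $r$ be an integer with $(n+1)/2 < r \le n$. Let $\theta=(\theta_1,\dots,\theta_n)\in\mathbb{R}^n$ and let $T_1,\dots,T_n$ be independent random variables with $T_i\sim N(\theta_i,1)$. Let $\Phi$ be the standard normal cumulative distribution function, and set $p_i = 1-\Phi(T_i)$ and $q_i=\Phi(T_i)=1-p_i$ for $i=1,\dots,n$. Let $p_{(1)}\le\dots\le p_{(n)}$ and $q_{(1)}\le\dots\le q_{(n)}$ denote the order statistics, and define the Bonferroni partial conjunction $p$-values $$p^+_{r/n}=(n-r+1)\,p_{(r)},\qquad p^-_{r/n}=(n-r+1)\,q_{(r)}.$$ Let $n^+=|\{i:\theta_i>0\}|$, $n^-=|\{i:\theta_i<0\}|$, and let $H_{r/n}$ be the null hypothesis $n^+<r$ and $n^-<r$. Then $p_{r/n}=\min\{p^+_{r/n},p^-_{r/n}\}$ is a valid $p$-value for $H_{r/n}$: for every $\alpha\in(0,1/2)$ and every $\theta\in\mathbb{R}^n$ with $n^+<r$ and $n^-<r$, $$\Pr_\theta\big(\min\{p^+_{r/n},p^-_{r/n}\}\le\alpha\big)\le\alpha.$$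
   Context: $H_{r/n}$ is the ''$r$ out of $n$ directional replicability'' null hypothesis: fewer than $r$ of the effects $\theta_i$ are positive and fewer than $r$ are negative. $p_i$ is the one-sided $p$-value for $\theta_i\le 0$ and $q_i$ the one-sided $p$-value for $\theta_i\ge 0$. *)

(* Defs.v *)
From HB Require Import structures.
From mathcomp Require Import all_boot all_order all_algebra.
From mathcomp Require Import all_classical all_reals all_analysis.
Set Implicit Arguments. Unset Strict Implicit. Unset Printing Implicit Defensive.
Import Order.TTheory GRing.Theory Num.Theory.
Local Open Scope classical_set_scope.
Local Open Scope ring_scope.

Definition std_normal_cdf {R : realType} (x : R) : R :=
  fine (normal_prob 0 1 `]-oo, x]).

Definition mutually_independent d (Omega : measurableType d) (R : realType)
    (P : probability Omega R) (n : nat) (X : 'I_n -> {RV P >-> R}) : Prop :=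
  forall (S : {set 'I_n}) (B : 'I_n -> set R),
    (forall i, measurable (B i)) ->
    P (\bigcap_(i in [set j | j \in S]) (X i @^-1` B i)) =
    (\prod_(i in S) P (X i @^-1` B i))%E.

Definition has_normal_law d (Omega : measurableType d) (R : realType)
    (P : probability Omega R) (X : {RV P >-> R}) (m : R) : Prop :=
  forall A : set R, measurable A -> distribution P X A = normal_prob m 1 A.

Definition order_stat {R : realType} (n : nat) (x : 'I_n -> R) (k : nat) : R :=
  nth 0 (sort <=%R [seq x i | i <- enum 'I_n]) k.-1.

Definition bonf_pc {R : realType} (n r : nat) (x : 'I_n -> R) : R :=
  (n - r + 1)%:R * order_stat x r.

(* Main.v *)
(* Put k = n - r + 1 and t = alpha / k, so that k t = alpha. Sort the effects
   and pair the m-th smallest with the m-th largest one, m = 1, ..., k. The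
   pairs are disjoint because 2 k <= n, and under the null hypothesis each of
   them consists of a nonpositive and a nonnegative effect. If at least r of
   the p_i (or of the q_i) are at most t, then by pigeonhole both members of
   some pair are. By the union bound and pairwise independence it remains to
   prove a a' + b b' <= t for a pair with effects theta <= 0 <= theta', where
   a, a' are the probabilities of p <= t and b, b' those of q <= t. The
   monotone likelihood ratio of the normal family puts (a, b) below the segment
   from (t, t) to (0, 1) and (a', b') below the one from (t, t) to (1, 0); the
   inequality is then elementary since t <= 1 / 2. *)

Require Import Defs.
From HB Require Import structures.
From mathcomp Require Import all_boot all_order all_algebra.
From mathcomp Require Import all_classical all_reals all_analysis.
From mathcomp Require Import measurable_realfun zify ring lra.
Import Order.TTheory GRing.Theory Num.Theory.
Local Open Scope classical_set_scope.
Local Open Scope ring_scope.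

(** * Monotone sets of reals under an atomless probability *)

Lemma cvg_mu_le d (T : measurableType d) (R : realType)
    (mu : probability T R) (F : nat -> set T) (t : \bar R) :
  (forall n, measurable (F n)) -> {homo F : n m / (n <= m)%N >-> n `<=` m} ->
  (forall n, (mu (F n) <= t)%E) -> (mu (\bigcup_n F n) <= t)%E.
Proof.
move=> mF homF Ft.
have mU : measurable (\bigcup_n F n) by exact: bigcupT_measurable.
have F_cvg := @nondecreasing_cvg_mu _ _ _ mu F mF mU
  (fun n m nm => introT (subsetPset _ _) (homF n m nm)).
rewrite -(cvg_lim _ F_cvg)//; apply: lime_le; first exact: cvgP F_cvg.
exact: nearW.
Qed.

(** Apart from a possible maximum, which has no mass, [B] is covered by an increasing sequence of
    half-lines, each ending below a point of [B]. Applied to the set where a p-value is at most [t],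
    this gives validity without any quantile function. *)
Lemma atomless_down_closed_le (R : realType)
    (mu : probability (measurableTypeR R) R) (B : set R) (t : \bar R) :
  (0 <= t)%E -> (forall x, mu [set x] = 0%E) ->
  (forall x y, x <= y -> B y -> B x) ->
  (forall x, B x -> (mu `]-oo, x]%classic <= t)%E) -> (mu B <= t)%E.
Proof.
move=> t0 mu1 Bdown Bt.
have mB : measurable B.
  by apply: is_interval_measurable => x y _ By z /andP[_ zy]; exact: Bdown By.
have [->|/set0P B0] := eqVneq B set0; first by rewrite measure0.
have subBt x y : B y -> x <= y -> (mu `]-oo, x]%classic <= t)%E.
  by move=> By xy; apply: Bt; exact: Bdown By.
have [[s sP]|/has_ubPn Bub] := pselect (has_ubound B).
  have supB : has_sup B by split=> //; exists s.
  pose F n : set R := `]-oo, sup B - n.+1%:R^-1]%classic.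
  have FU : B `<=` \bigcup_n F n `|` [set sup B].
    move=> x Bx; have := sup_upper_bound supB Bx.
    rewrite le_eqVlt => /orP[/eqP ->|xs]; [by right|left].
    have [k xk] := ltr_add_invr xs; exists k => //.
    by rewrite /F/= in_itv/= lerBrDr ltW.
  have mF n : measurable (F n) by exact: measurable_itv.
  have mU : measurable (\bigcup_n F n) by exact: bigcupT_measurable.
  apply: (@le_trans _ _ (mu (\bigcup_n F n `|` [set sup B]))).
    by rewrite le_measure ?inE//; exact: measurableU.
  apply: (le_trans (measureU2 mu _ _)) => //.
  rewrite [X in (_ + X)%E]mu1 adde0; apply: cvg_mu_le => //.
    move=> n m nm x; rewrite /F/= !in_itv/= => /le_trans; apply.
    by rewrite lerB// lef_pV2 ?posrE// ler_nat ltnS.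
  move=> n; have [|y By] := @sup_adherent _ B n.+1%:R^-1 _ supB.
    by rewrite invr_gt0.
  by move=> /ltW; exact: subBt.
(* Here [B] is unbounded above, so every integer lies below one of its points. *)
pose F n : set R := `]-oo, n%:R]%classic.
have mF n : measurable (F n) by exact: measurable_itv.
have mU : measurable (\bigcup_n F n) by exact: bigcupT_measurable.
apply: (@le_trans _ _ (mu (\bigcup_n F n))).
  rewrite le_measure ?inE// => x Bx; exists (Num.Def.archi_bound `|x|) => //.
  rewrite /F/= in_itv/= (le_trans (ler_norm x))// ltW//.
  by apply: archi_boundP.
apply: cvg_mu_le => // [n m nm x|n].
  by rewrite /F/= !in_itv/= => /le_trans; apply; rewrite ler_nat.
by have [y By /ltW] := Bub n%:R; exact: subBt.
Qed.

(** The reflection [x |-> - x] reduces this to the down-closed case, for the pushforward of [mu]. *)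
Lemma atomless_up_closed_le (R : realType)
    (mu : probability (measurableTypeR R) R) (C : set R) (t : \bar R) :
  (0 <= t)%E -> (forall x, mu [set x] = 0%E) ->
  (forall x y, x <= y -> C x -> C y) ->
  (forall x, C x -> (mu `]x, +oo[%classic <= t)%E) -> (mu C <= t)%E.
Proof.
move=> t0 mu1 Cup Ct.
have mN : measurable_fun (setT : set (measurableTypeR R))
    (-%R : measurableTypeR R -> measurableTypeR R) by exact: oppr_measurable.
pose X : {mfun measurableTypeR R >-> measurableTypeR R} := 
  HB.pack (-%R : R -> R) (isMeasurableFun.Build _ _ _ _ _ mN).
have nuE A : distribution mu X A = mu (-%R @^-1` A) by [].
have -> : C = -%R @^-1` (-%R @` C).
  apply/seteqP; split=> [x Cx|x [y Cy /oppr_inj <-]//]; by exists x.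
rewrite -nuE; apply: atomless_down_closed_le => //.
- move=> x; rewrite -(mu1 (- x)); congr (mu _).
  by apply/seteqP; split=> y/= => [<-|->]; rewrite opprK.
- move=> x y xy [z Cz zy]; exists (- x); last exact: opprK.
  by apply: Cup Cz; rewrite lerNr zy.
- move=> _ [x Cx <-]; change (mu (-%R @^-1` `]-oo, (- x)%R]%classic) <= t)%E.
  (* Reflection yields the closed ray, while the hypothesis bounds the open one; they differ by a
     null point. *)
  have -> : -%R @^-1` `]-oo, - x]%classic = `]x, +oo[%classic `|` [set x].
    apply/seteqP; split=> y/=; rewrite !in_itv/= andbT lerN2 le_eqVlt.
      by case/orP=> [/eqP ->|]; [right|left].
    by case=> [->|->]; rewrite ?eqxx ?orbT.
  apply: (le_trans (measureU2 mu _ _)) => //.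
  by rewrite [X in (_ + X)%E]mu1 adde0; exact: Ct.
Qed.

(** * Change of mean in the normal law *)

Lemma normal_prob_set1 (R : realType) (m x : R) : normal_prob m 1 [set x] = 0%E.
Proof.
have /null_content_dominatesP := @normal_prob_dominates R m 1.
by apply => //; exact: lebesgue_measure_set1.
Qed.

(** The factor is the likelihood ratio of N(m, 1) to N(0, 1), monotone in [x] in the direction given
    by the sign of [m]. *)
Lemma normal_pdf_shift (R : realType) (m x : R) :
  normal_pdf m 1 x = expR (m * x - m ^+ 2 / 2) * normal_pdf 0 1 x.
Proof.
rewrite !normal_pdfE ?oner_neq0// /normal_fun mulrCA -expRD.
by congr (_ * expR _); field.
Qed.

Lemma normal_prob_fin_num (R : realType) (m : R) (A : set R) :
  measurable A -> normal_prob m 1 A \is a fin_num.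
Proof. by move=> mA; exact: fin_num_measure. Qed.

Section normal_prob_shift.
Variables (R : realType) (m c : R) (A : set R).
Hypotheses (mA : measurable A) (c0 : 0 <= c).

Let mpdf k : measurable_fun A (fun x : R => (normal_pdf k 1 x)%:E).
Proof.
by apply/measurable_EFinP; apply: measurable_funTS; exact: measurable_normal_pdf.
Qed.

Let mcpdf k : measurable_fun A (fun x : R => (c%:E * (normal_pdf k 1 x)%:E)%E).
Proof. by apply: emeasurable_funM. Qed.

Let pdf_ge0 k (x : R) : A x -> (0 <= (normal_pdf k 1 x)%:E)%E.
Proof. by rewrite lee_fin normal_pdf_ge0. Qed.

Let cpdf_ge0 k (x : R) : A x -> (0 <= c%:E * (normal_pdf k 1 x)%:E)%E.
Proof. by move=> Ax; rewrite mule_ge0 ?lee_fin ?normal_pdf_ge0. Qed.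

Let cprobE k : (\int[lebesgue_measure]_(x in A)
  (c%:E * (normal_pdf k 1 x)%:E) = c%:E * normal_prob k 1 A)%E.
Proof. by apply: ge0_integralZl => //; [exact: mpdf|exact: pdf_ge0]. Qed.

Let fine_cprob k : fine (\int[lebesgue_measure]_(x in A)
  (c%:E * (normal_pdf k 1 x)%:E))%E = c * fine (normal_prob k 1 A).
Proof. by rewrite cprobE fineM ?normal_prob_fin_num. Qed.

Let cprob_fin k : (\int[lebesgue_measure]_(x in A)
  (c%:E * (normal_pdf k 1 x)%:E))%E \is a fin_num.
Proof. by rewrite cprobE fin_numM// normal_prob_fin_num. Qed.

Lemma normal_prob_shift_le : (forall x, A x -> expR (m * x - m ^+ 2 / 2) <= c) ->
  fine (normal_prob m 1 A) <= c * fine (normal_prob 0 1 A).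
Proof.
move=> Ac; rewrite -fine_cprob fine_le ?normal_prob_fin_num ?cprob_fin//.
apply: ge0_le_integral; [by []|exact: pdf_ge0|exact: mpdf|exact: mcpdf|].
move=> x Ax; rewrite lee_fin (normal_pdf_shift R m).
by rewrite ler_wpM2r ?normal_pdf_ge0 ?Ac.
Qed.

Lemma normal_prob_shift_ge : (forall x, A x -> c <= expR (m * x - m ^+ 2 / 2)) ->
  c * fine (normal_prob 0 1 A) <= fine (normal_prob m 1 A).
Proof.
move=> Ac; rewrite -fine_cprob fine_le ?normal_prob_fin_num ?cprob_fin//.
apply: ge0_le_integral; [by []|exact: cpdf_ge0|exact: mcpdf|exact: mpdf|].
move=> x Ax; rewrite lee_fin (normal_pdf_shift R m).
by rewrite ler_wpM2r ?normal_pdf_ge0 ?Ac.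
Qed.

End normal_prob_shift.

(* Locked: unification would otherwise unfold the integrals of distinct sets. *)
HB.lock Definition normal_mass {R : realType} (m : R) (A : set R) : R :=
  fine (normal_prob m 1 A).

Section normal_mass.
Variables (R : realType) (m : R).
Implicit Types A B : set R.

Lemma normal_massE A : measurable A -> normal_prob m 1 A = (normal_mass m A)%:E.
Proof. by move=> mA; rewrite normal_mass.unlock fineK ?normal_prob_fin_num. Qed.

Lemma normal_mass_ge0 A : 0 <= normal_mass m A.
Proof. by rewrite normal_mass.unlock fine_ge0. Qed.

Lemma normal_mass_le1 A : measurable A -> normal_mass m A <= 1.
Proof. by move=> mA; rewrite -lee_fin -normal_massE//; exact: probability_le1. Qed.

Lemma normal_mass_setC A : measurable A ->
  normal_mass m (~` A) = 1 - normal_mass m A.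
Proof.
move=> mA; apply: EFin_inj; rewrite -normal_massE; last exact: measurableC.
by rewrite EFinB -normal_massE//; exact: probability_setC.
Qed.

Lemma normal_mass_set0 : normal_mass m set0 = 0.
Proof. by rewrite normal_mass.unlock measure0. Qed.

Lemma normal_mass_setT : normal_mass m setT = 1.
Proof. by rewrite normal_mass.unlock probability_setT. Qed.

Lemma normal_mass_setD A B : measurable A -> measurable B -> B `<=` A ->
  normal_mass m A = normal_mass m B + normal_mass m (A `\` B).
Proof.
move=> mA mB BA; have mAB : measurable (A `\` B) by exact: measurableD.
apply: EFin_inj; rewrite EFinD -!normal_massE// -[in LHS](setDUK BA) measureU//.
exact: setDIK.
Qed.

End normal_mass.

(* The likelihood ratio x |-> expR (m x - m^2 / 2) is at most c on B and at
   least c on D \ B, where c is its supremum over B. *)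
Lemma normal_mass_mlr (R : realType) (m : R) (B D : set R) :
  measurable B -> measurable D -> B `<=` D ->
  (forall x y, B x -> D y -> ~ B y -> m * x <= m * y) ->
  normal_mass m B * normal_mass 0 D <= normal_mass 0 B * normal_mass m D.
Proof.
move=> mB mD BD Bm.
have mDB : measurable (D `\` B) by exact: measurableD.
have [->|/set0P[x0 Bx0]] := eqVneq B set0.
  by rewrite !normal_mass_set0 !mul0r.
have split_D k := @normal_mass_setD R k D B mD mB BD.
(* A point of [D] outside [B] bounds the likelihood ratio on [B], so that its supremum exists; hence
   the separate case. *)
have [DB0|/set0P[y0 [Dy0 By0]]] := eqVneq (D `\` B) set0.
  by rewrite !split_D DB0 !normal_mass_set0 !addr0 mulrC.
pose g x := expR (m * x - m ^+ 2 / 2).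
have gle x y : B x -> D y -> ~ B y -> g x <= g y.
  by move=> Bx Dy By; rewrite ler_expR lerB// Bm.
have supg : has_sup (g @` B).
  split; first by exists (g x0), x0.
  by exists (g y0) => _ [x Bx <-]; exact: gle.
have c0 : 0 <= sup (g @` B).
  apply: (le_trans (expR_ge0 (m * x0 - m ^+ 2 / 2))).
  by apply: sup_upper_bound => //; exists x0.
have leB : normal_mass m B <= sup (g @` B) * normal_mass 0 B.
  rewrite normal_mass.unlock; apply: normal_prob_shift_le => // x Bx.
  by apply: sup_upper_bound => //; exists x.
have geD : sup (g @` B) * normal_mass 0 (D `\` B) <= normal_mass m (D `\` B).
  rewrite normal_mass.unlock; apply: normal_prob_shift_ge => // y [Dy By].
  by apply: sup_le_ub; [exists (g x0), x0|move=> _ [x Bx <-]; exact: gle].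
(* The two products share a middle term; after splitting [D], the summand
   [normal_mass m B * normal_mass 0 B] is common to both sides. *)
have := ler_wpM2r (normal_mass_ge0 R 0 (D `\` B)) leB.
have := ler_wpM2l (normal_mass_ge0 R 0 B) geD.
rewrite !split_D; nra.
Qed.

(** [B] is the tail that the mean [m] makes less likely, and [l] runs along the segment from (0, 1)
    to (t, t). It is the ratio of the masses of [B] under [m] and 0: comparing [B] with the whole
    line gives [l <= 1], comparing it with the complement of [A] gives the bound on [A]. *)
Lemma normal_tails_dominated (R : realType) (m t : R) (A B : set R) :
  measurable A -> measurable B -> A `&` B = set0 ->
  (forall x y, B x -> ~ B y -> m * x <= m * y) ->
  normal_mass 0 A <= t -> normal_mass 0 B <= t ->
  exists l, [/\ 0 <= l <= 1, normal_mass m B <= l * t &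
    normal_mass m A <= 1 - l * (1 - t)].
Proof.
move=> mA mB AB0 Bm A0t B0t.
have mlrC : normal_mass m B * (1 - normal_mass 0 A) <=
    normal_mass 0 B * (1 - normal_mass m A).
  rewrite -!normal_mass_setC//; apply: normal_mass_mlr => //.
  - exact: measurableC.
  - by move=> x Bx Ax; have : (A `&` B) x by []; rewrite AB0.
  - by move=> x y Bx _; exact: Bm.
have mlrT : normal_mass m B <= normal_mass 0 B.
  rewrite -[leLHS]mulr1 -[leRHS]mulr1.
  rewrite -{1}(normal_mass_setT R 0) -(normal_mass_setT R m).
  by apply: normal_mass_mlr => // x y Bx _; exact: Bm.
have a0 := normal_mass_ge0 R m A; have b0 := normal_mass_ge0 R m B.
have B00 := normal_mass_ge0 R 0 B; have a1 := normal_mass_le1 R m A mA.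
have [B0_eq0|B0_neq0] := eqVneq (normal_mass 0 B) 0.
  by exists 0; split; lra.
have B0_gt0 : 0 < normal_mass 0 B by rewrite lt_def B0_neq0.
exists (normal_mass m B / normal_mass 0 B); split.
- by rewrite divr_ge0//= ler_pdivrMr// mul1r.
- by rewrite mulrAC ler_pdivlMr// ler_wpM2l.
- rewrite lerBrDr addrC -lerBrDr mulrAC ler_pdivrMr// [leRHS]mulrC.
  by apply: le_trans mlrC; rewrite ler_wpM2l// lerB.
Qed.

(** Inserting the upper bounds leaves a polynomial in [l] and [u] whose distance to [t] is visibly
    nonnegative once [2 * t <= 1]. It is tight at (l, u) = (0, 1) and (1, 0): one effect zero, the
    other infinite. *)
Lemma dominated_pair_le (R : realFieldType) (t l u a1 b1 a2 b2 : R) :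
  0 <= t <= 1 / 2 -> 0 <= l <= 1 -> 0 <= u <= 1 ->
  0 <= a1 -> 0 <= b1 -> 0 <= a2 -> 0 <= b2 ->
  a1 <= l * t -> b1 <= 1 - l * (1 - t) ->
  b2 <= u * t -> a2 <= 1 - u * (1 - t) -> a1 * a2 + b1 * b2 <= t.
Proof.
move=> /andP[t0 t1] /andP[l0 l1] /andP[u0 u1] a1_0 b1_0 a2_0 b2_0 a1l b1l b2u a2u.
apply: (@le_trans _ _ (l * t * (1 - u * (1 - t)) + (1 - l * (1 - t)) * (u * t))).
  by rewrite lerD// ler_pM.
rewrite -subr_ge0.
have -> : t - (l * t * (1 - u * (1 - t)) + (1 - l * (1 - t)) * (u * t)) =
    t * ((1 - l) * (1 - u) + l * u * (1 - 2 * t)) by ring.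
rewrite mulr_ge0// addr_ge0// mulr_ge0 ?mulr_ge0 ?subr_ge0//.
by lra.
Qed.

(** * Counting: order statistics and pairs of effects *)

Lemma count_enum (T : finType) (p : pred T) : count p (enum T) = #|p|.
Proof. by rewrite enumT cardE /enum_mem size_filter. Qed.

(** This replaces sorting by counting. The bounds on [r] protect the shift [r.-1] and keep the index
    off the default value of [nth]. *)
Lemma order_stat_le (R : realType) (n r : nat) (x : 'I_n -> R) (c : R) :
  (0 < r <= n)%N -> (order_stat x r <= c) = (r <= #|[pred i | (x i <= c)%R]|)%N.
Proof.
move=> /andP[r0 rn]; rewrite /order_stat.
set s := sort _ _.
have s_sorted : sorted <=%R s by exact: sort_le_sorted.
have cnt : count (<= c) s = #|[pred i | (x i <= c)%R]|.
  by rewrite count_sort count_map count_enum; apply: eq_card.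
have [rc|cr] := leqP r #|_|.
  by apply: nth_count_le => //; rewrite cnt prednK.
apply/negbTE; rewrite -ltNge; apply: nth_count_gt => //.
rewrite cnt size_sort size_map size_enum_ord.
by case: r r0 rn cr => // r _ rn cr; rewrite -ltnS cr.
Qed.

(** At most [n - k] effects are positive, so the [k] smallest are nonpositive; dually, the [k]
    largest are nonnegative. *)
Lemma sign_pairing (R : realType) (n k : nat) (theta : 'I_n -> R) :
  (0 < k)%N -> (k + k <= n)%N ->
  (#|[pred i | (0 < theta i)%R]| + k <= n)%N ->
  (#|[pred i | (theta i < 0)%R]| + k <= n)%N ->
  exists i j : 'I_k -> 'I_n, [/\ injective i, injective j,
    forall a b, i a != j b, forall a, theta (i a) <= 0 &
    forall a, 0 <= theta (j a)].
Proof.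
move=> k0 kkn npos nneg.
have n0 : (0 < n)%N by lia.
pose s := sort (relpre theta <=%R) (enum 'I_n).
have size_s : size s = n by rewrite size_sort size_enum_ord.
have uniq_s : uniq s by rewrite sort_uniq enum_uniq.
pose i0 := Ordinal n0.
have sorted_s : sorted <=%R (map theta s).
  by rewrite sorted_map; apply: sort_sorted => a b; exact: le_total.
have theta_nth a : (a < n)%N -> theta (nth i0 s a) = nth 0 (map theta s) a.
  by move=> an; rewrite (nth_map i0)// size_s.
have cnt p : count p (map theta s) = #|[pred i | p (theta i)]|.
  by rewrite count_map count_sort count_enum.
have card_le0 : (k <= #|[pred i | (theta i <= 0)%R]|)%N.
  have := cardC [pred i | (0 < theta i)%R].
  rewrite card_ord (@eq_card _ (predC _) [pred i | (theta i <= 0)%R]).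
    by move: npos; move: #|_| #|_| => a b; lia.
  by move=> i; rewrite !inE -leNgt.
have inj_nth (f : 'I_k -> nat) : injective f -> (forall a, f a < n)%N ->
    injective (fun a => nth i0 s (f a)).
  move=> injf fn a b /eqP; rewrite nth_uniq ?size_s//.
  by move=> /eqP /injf.
(* The first [k] and the last [k] positions do not meet, because [k + k <= n]. *)
exists (fun a => nth i0 s a), (fun a => nth i0 s (n - a.+1)); split.
- by apply: inj_nth => [a b /ord_inj//|a]; have := ltn_ord a; lia.
- apply: inj_nth => [a b ab|a]; last by lia.
  by apply: ord_inj; have := ltn_ord a; have := ltn_ord b; lia.
- move=> a b; have ak := ltn_ord a; have bk := ltn_ord b.
  by rewrite nth_uniq ?size_s//; lia.
- move=> a; have := ltn_ord a => ak; rewrite theta_nth; last lia.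
  by apply: nth_count_le => //; rewrite cnt; exact: leq_trans card_le0.
- move=> a; have := ltn_ord a => ak; rewrite theta_nth; last lia.
  apply: nth_count_ge => //; rewrite cnt size_map size_s.
  by move: nneg; move: #|_| => c cn; lia.
Qed.

(** Otherwise [f] picks from each pair a member outside [p]. The pairs being disjoint, this makes
    [k] distinct indices outside [p], where fewer than [k] exist. *)
Lemma pair_pigeonhole (n k : nat) (i j : 'I_k -> 'I_n) (p : pred 'I_n) :
  injective i -> injective j -> (forall a b, i a != j b) ->
  (n < #|p| + k)%N -> exists a, p (i a) && p (j a).
Proof.
move=> inji injj ij; apply: contraPP => /forallNP nop.
pose f a := if p (i a) then j a else i a.
have injf : injective f.
  move=> a b; rewrite /f; case: ifP => _; case: ifP => _.
  - exact: injj.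
  - by move=> /esym/eqP; rewrite (negbTE (ij _ _)).
  - by move=> /eqP; rewrite (negbTE (ij _ _)).
  - exact: inji.
have : (#|codom f| <= #|predC [in p]|)%N.
  apply/subset_leq_card/fintype.subsetP => _ /codomP[a ->].
  change (~~ p (f a)); rewrite /f.
  have := nop a; by case: ifP => [_ /= /negP|->].
have := cardC p; rewrite card_codom// !card_ord.
by move: #|p| #|predC _| => a b; lia.
Qed.

(** * Counting events and pairwise independence *)

(** The event is a finite union, over the index sets [S] of size at least [r], of finite
    intersections. *)
Lemma measurable_card_ge d (T : measurableType d) (n r : nat)
    (E : 'I_n -> set T) : (forall i, measurable (E i)) ->
  measurable [set w | (r <= #|[pred i | w \in E i]|)%N].
Proof.
move=> mE.
have -> : [set w | (r <= #|[pred i | w \in E i]|)%N] =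
    \bigcup_(S in [set S : {set 'I_n} | (r <= #|S|)%N])
      \bigcap_(i in [set j | j \in S]) E i.
  apply/seteqP; split=> w /=.
    move=> rw; exists [set i | w \in E i]%SET; first by rewrite /= cardsE.
    by move=> i/=; rewrite !inE.
  move=> [S/= rS Sw]; apply: leq_trans rS _; apply/subset_leq_card.
  by apply/fintype.subsetP => i iS; rewrite !inE; exact: Sw.
apply: fin_bigcup_measurable => [|S _]; first exact: finite_finset.
apply: fin_bigcap_measurable => [|i _]; [exact: finite_finset|exact: mE].
Qed.

Lemma mutually_independent2 d (Omega : measurableType d) (R : realType)
    (P : probability Omega R) (n : nat) (X : 'I_n -> {RV P >-> R})
    (A : set R) (i j : 'I_n) :
  mutually_independent X -> measurable A -> i != j ->
  P (X i @^-1` A `&` X j @^-1` A) = (P (X i @^-1` A) * P (X j @^-1` A))%E.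
Proof.
move=> indX mA ij; have := indX [set i; j]%SET (fun=> A) (fun=> mA).
rewrite big_setU1 ?inE//= big_set1 => <-; congr (P _).
apply/seteqP; split=> w /=.
  by move=> [Ai Aj] l/=; rewrite !inE => /orP[]/eqP ->.
by move=> Aij; split; apply: (Aij _ _); rewrite /= !inE eqxx ?orbT.
Qed.

(** * Regions where a one-sided p-value is small *)

Lemma std_normal_cdf_le (R : realType) (x y : R) :
  x <= y -> std_normal_cdf x <= std_normal_cdf y.
Proof.
move=> xy; rewrite /std_normal_cdf fine_le ?normal_prob_fin_num//.
by rewrite le_measure ?inE//; exact: subitvPr.
Qed.

Section rejection_regions.
Variables (R : realType) (t : R).
Hypotheses (t0 : 0 <= t) (t_lt : t < 1 / 2).

Let A : set R := [set x | 1 - std_normal_cdf x <= t].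
Let B : set R := [set x | std_normal_cdf x <= t].

Let A_up x y : x <= y -> A x -> A y.
Proof. by move=> /std_normal_cdf_le; rewrite /A/=; lra. Qed.

Let B_down x y : x <= y -> B y -> B x.
Proof. by move=> /std_normal_cdf_le; rewrite /B/=; lra. Qed.

Lemma measurable_small_p : measurable A.
Proof.
by apply: is_interval_measurable => x y Ax _ z /andP[xz _]; exact: A_up Ax.
Qed.

Lemma measurable_small_q : measurable B.
Proof.
by apply: is_interval_measurable => x y _ By z /andP[_ zy]; exact: B_down By.
Qed.

Lemma small_pq_disjoint : A `&` B = set0.
Proof.
rewrite -subset0 => x [Ax Bx]; have : 1 / 2 <= t by move: Ax Bx; rewrite /A /B/=; lra.
by rewrite leNgt t_lt.
Qed.

(** Validity of the p-value at effect 0: the ray beyond a point [x] of [A] has mass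
    [1 - std_normal_cdf x], which is at most [t]. *)
Lemma small_p_mass : normal_mass 0 A <= t.
Proof.
rewrite -lee_fin -normal_massE; last exact: measurable_small_p.
apply: (@atomless_up_closed_le R (normal_prob 0 1)) => //.
- by move=> x; exact: normal_prob_set1.
- move=> x Ax; rewrite -setCitvl -[leLHS]/(normal_prob 0 1 _).
  rewrite normal_massE; last exact: measurableC.
  by rewrite normal_mass_setC// lee_fin normal_mass.unlock.
Qed.

Lemma small_q_mass : normal_mass 0 B <= t.
Proof.
rewrite -lee_fin -normal_massE; last exact: measurable_small_q.
apply: (@atomless_down_closed_le R (normal_prob 0 1)) => //.
- by move=> x; exact: normal_prob_set1.
- by move=> x Bx; rewrite -[leLHS]/(normal_prob 0 1 _) normal_massE// lee_fin normal_mass.unlock.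
Qed.

Lemma opposite_pair_le (m1 m2 : R) : m1 <= 0 -> 0 <= m2 ->
  normal_mass m1 A * normal_mass m2 A + normal_mass m1 B * normal_mass m2 B <= t.
Proof.
move=> m1_le0 m2_ge0.
(* A nonpositive mean disfavours the upper tail, so [A] is the dominated region here, and [B] in the
   second application. *)
have [l [l01 Al Bl]] : exists l, [/\ 0 <= l <= 1, normal_mass m1 A <= l * t &
    normal_mass m1 B <= 1 - l * (1 - t)].
  apply: normal_tails_dominated.
  - exact: measurable_small_q.
  - exact: measurable_small_p.
  - by rewrite setIC small_pq_disjoint.
  - move=> x y Ax Ay; rewrite ler_wnM2l// ltW// ltNge.
    by apply/negP => xy; apply: Ay; exact: A_up Ax.
  - exact: small_q_mass.
  - exact: small_p_mass.
have [u [u01 Bu Au]] : exists u, [/\ 0 <= u <= 1, normal_mass m2 B <= u * t &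
    normal_mass m2 A <= 1 - u * (1 - t)].
  apply: normal_tails_dominated.
  - exact: measurable_small_p.
  - exact: measurable_small_q.
  - exact: small_pq_disjoint.
  - move=> x y Bx By; rewrite ler_wpM2l// ltW// ltNge.
    by apply/negP => yx; apply: By; exact: B_down Bx.
  - exact: small_p_mass.
  - exact: small_q_mass.
apply: (@dominated_pair_le R t l u) => //; try exact: normal_mass_ge0.
by rewrite t0 ltW.
Qed.

End rejection_regions.

(** * From partial conjunction p-values to a union bound over pairs *)

Lemma bonf_pc_le (R : realType) (n r : nat) (x : 'I_n -> R) (alpha : R) :
  (0 < r <= n)%N ->
  (bonf_pc r x <= alpha) =
  (r <= #|[pred i | (x i <= alpha / (n - r + 1)%:R)%R]|)%N.
Proof.
by move=> rn; rewrite -order_stat_le// /bonf_pc ler_pdivlMr 1?mulrC// addn1.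
Qed.

Theorem theorem1 (R : realType) (d : measure_display) (Omega : measurableType d)
    (P : probability Omega R) (n r : nat) (theta : 'I_n -> R)
    (T : 'I_n -> {RV P >-> R}) (alpha : R) :
  (1 <= n)%N -> (n.+1 < 2 * r)%N -> (r <= n)%N ->
  mutually_independent T ->
  (forall i, has_normal_law (T i) (theta i)) ->
  0 < alpha -> alpha < 1 / 2 ->
  (#|[pred i | (0 < theta i)%R]| < r)%N ->
  (#|[pred i | (theta i < 0)%R]| < r)%N ->
  (P [set w | (Num.min
         (bonf_pc r (fun i => (1 - std_normal_cdf (T i w))%R))
         (bonf_pc r (fun i => std_normal_cdf (T i w))) <= alpha)%R]
     <= alpha%:E)%E.
Proof.
move=> n1 nr rn indT lawT alpha0 alpha_lt npos nneg.
(* [k] is both the Bonferroni factor and the number of pairs, so the union bound costs exactly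
   [alpha]. *)
pose k := (n - r + 1)%N; pose t : R := alpha / k%:R.
have k0 : (0 < k)%N by rewrite /k addn1.
have kR : (0 : R) < k%:R by rewrite ltr0n.
have t0 : 0 <= t by rewrite divr_ge0// ltW.
have t_lt : t < 1 / 2.
  by apply: le_lt_trans alpha_lt; rewrite ler_pdivrMr// ler_peMr ?ler1n// ltW.
pose A : set R := [set x | 1 - std_normal_cdf x <= t].
pose B : set R := [set x | std_normal_cdf x <= t].
have mA : measurable A by exact: measurable_small_p.
have mB : measurable B by exact: measurable_small_q.
have mT i (C : set R) : measurable C -> measurable (T i @^-1` C).
  by move=> mC; rewrite -[X in measurable X]setTI; exact: measurable_funPT.
have PT i (C : set R) : measurable C -> P (T i @^-1` C) = (normal_mass (theta i) C)%:E.
  by move=> mC; rewrite -normal_massE//; exact: lawT.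
pose many C : set Omega := [set w | (r <= #|[pred i | w \in T i @^-1` C]|)%N].
have mmany C : measurable C -> measurable (many C).
  by move=> mC; apply: measurable_card_ge => i; exact: mT.
have -> : [set w | (Num.min
    (bonf_pc r (fun i => (1 - std_normal_cdf (T i w))%R))
    (bonf_pc r (fun i => std_normal_cdf (T i w))) <= alpha)%R] =
    many A `|` many B.
  have r0n : (0 < r <= n)%N by lia.
  (* Stated for a general [f] to serve the p-values and the q-values alike. *)
  have manyE C (f : R -> R) w : (forall x, C x <-> f x <= t) ->
      (bonf_pc r (fun i => f (T i w)) <= alpha) <-> many C w.
    move=> Cf; rewrite bonf_pc_le//; rewrite /many/=.
    suff -> : #|[pred i | (f (T i w) <= t)%R]| = #|[pred i | w \in T i @^-1` C]| by [].
    apply: eq_card => i; rewrite !inE; apply/idP/idP => [/Cf/mem_set//|].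
    by move=> /set_mem /Cf.
  apply/seteqP; split=> w /=.
    rewrite ge_min => /orP[].
      by rewrite (manyE A (fun x => 1 - std_normal_cdf x))//; left.
    by rewrite (manyE B std_normal_cdf)//; right.
  rewrite ge_min => -[|].
    by move=> /(manyE A (fun x => 1 - std_normal_cdf x)) ->.
  by move=> /(manyE B std_normal_cdf) ->; rewrite ?orbT.
have [||||i [j [inji injj ij i_le0 j_ge0]]] := @sign_pairing R n k theta.
- by [].
(* [k + k <= n] is the assumption [n.+1 < 2 * r]. *)
- by rewrite /k; lia.
- by rewrite /k; move: npos; move: #|_| => c; lia.
- by rewrite /k; move: nneg; move: #|_| => c; lia.
pose both C a := T (i a) @^-1` C `&` T (j a) @^-1` C.
have mboth C a : measurable C -> measurable (both C a).
  by move=> mC; apply: measurableI; exact: mT.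
have many_both C : many C `<=` \bigcup_(a in setT) both C a.
  move=> w rw; have [|a /andP[ia ja]] := @pair_pigeonhole n k i j
    [pred l | w \in T l @^-1` C] inji injj ij.
    (* The pigeonhole applies because [r + k = n + 1]. *)
    by move: rw; rewrite /many/= /k; move: #|_| => c; lia.
  by exists a => //; split; exact: set_mem.
have Pboth C a : measurable C -> P (both C a) =
    (normal_mass (theta (i a)) C * normal_mass (theta (j a)) C)%:E.
  by move=> mC; rewrite mutually_independent2// !PT.
have mU a : measurable (both A a `|` both B a).
  by apply: measurableU; exact: mboth.
(* Extension by the empty set to all of [nat], the index type of the union bound. *)
pose G (m : nat) := oapp (fun a : 'I_k => both A a `|` both B a) set0 (insub m).
have GE (a : 'I_k) : G a = both A a `|` both B a by rewrite /G valK.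
have mG m : measurable (G m).
  by rewrite /G; case: (insub m) => [a|] /=; [exact: mU|exact: measurable0].
apply: (@le_trans _ _ (P (\big[setU/set0]_(m < k) G m))).
  rewrite le_measure ?inE//.
  - by apply: measurableU; exact: mmany.
  - exact: bigsetU_measurable.
  - rewrite -bigcup_mkord => w [] /many_both[a _ wa]; exists a => //=;
      rewrite GE; by [left|right].
apply: le_trans (le_mu_bigsetU _ _) _ => //.
apply: (@le_trans _ _ (\sum_(m < k) t%:E)%E).
  apply: lee_sum => a _; rewrite GE.
  have : (P (both A a `|` both B a) <= P (both A a) + P (both B a))%E.
    by apply: measureU2; exact: mboth.
  move=> /le_trans; apply.
  by rewrite !Pboth// -EFinD lee_fin opposite_pair_le.
by rewrite sumEFin lee_fin sumr_const card_ord -mulr_natr divfK// gt_eqF.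
Qed.
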